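(* Let $\mathbb{O} = \{y\in\mathbb{R}^n : A y \preceq_{\mathcal K} b\}$ be an obstacle, where $A\in\mathbb{R}^{l\times n}$, $b\in\mathbb{R}^l$, $n\ge 1$, $\mathcal K\subset\mathbb{R}^l$ is a closed convex pointed cone with non-empty interior, and $\mathbb{O}$ is a convex compact set with non-empty relative interior. Let the controlled object at state $x\in\mathbb{R}^{n_x}$ occupy the set $\mathbb{E}(x) = R(x)\mathbb{B}+t(x)$, where $R(x)\in\mathbb{R}^{n\times n}$ is an (orthogonal) rotation matrix, $t(x)\in\mathbb{R}^n$ is a translation vector, and $\mathbb{B}=\{y\in\mathbb{R}^n : G y\preceq_{\bar{\mathcal K}} g\}$ is a convex compact set with non-empty relative interior, with $G\in\mathbb{R}^{h\times n}$, $g\in\mathbb{R}^h$, and $\bar{\mathcal K}\subset\mathbb{R}^h$ a closed convex pointed cone. Let $\|\cdot\|$ be a norm on $\mathbb{R}^n$ with dual norm $\|\cdot\|_*$. Then, for any $\mathsf{d}\in\mathbb{R}$, $$\mathrm{sd}(\mathbb{E}(x),\mathbb{O}) > \mathsf{d}$$ if and only if there exist $\lambda\succeq_{\mathcal K^*}0$ and $\mu\succeq_{\bar{\mathcal K}^*}0$ such that $$-g^\top\mu + (A t(x)-b)^\top\lambda > \mathsf{d},\qquad G^\top\mu + R(x)^\top A^\top\lambda = 0,\qquad \|A^\top\lambda\|_*= 1.$$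
   Context: For a cone $\mathcal K$ in a Euclidean space and vectors $a,c$ in that space, $a\preceq_{\mathcal K} c$ means $c-a\in\mathcal K$. $\mathcal K^*=\{\lambda : \lambda^\top s\ge 0 \text{ for all } s\in\mathcal K\}$ is the dual cone, and $\lambda\succeq_{\mathcal K^*}0$ means $\lambda\in\mathcal K^*$; likewise for $\bar{\mathcal K}$. The dual norm is $\|z\|_*=\max\{z^\top y : \|y\|\le 1\}$. For sets $\mathbb{E},\mathbb{O}\subset\mathbb{R}^n$, the distance is $\mathrm{dist}(\mathbb{E},\mathbb{O}) := \min_{t\in\mathbb{R}^n}\{\|t\| : (\mathbb{E}+t)\cap\mathbb{O}\neq\emptyset\}$, the penetration is $\mathrm{pen}(\mathbb{E},\mathbb{O}) := \inf_{t\in\mathbb{R}^n}\{\|t\| : (\mathbb{E}+t)\cap\mathbb{O}=\emptyset\}$, and the signed distance is $\mathrm{sd}(\mathbb{E},\mathbb{O}) := \mathrm{dist}(\mathbb{E},\mathbb{O}) - \mathrm{pen}(\mathbb{E},\mathbb{O})$. The maps $R:\mathbb{R}^{n_x}\to\mathbb{R}^{n\times n}$ and $t:\mathbb{R}^{n_x}\to\mathbb{R}^n$ are assumed smooth. *)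

(* Defs.v *)
From HB Require Import structures.
From mathcomp Require Import all_boot all_order all_algebra.
From mathcomp Require Import all_classical all_reals all_analysis.

Set Implicit Arguments.
Unset Strict Implicit.
Unset Printing Implicit Defensive.

Import Order.TTheory GRing.Theory Num.Theory.
Import numFieldNormedType.Exports.

Local Open Scope classical_set_scope.
Local Open Scope ring_scope.

(* R^m is 'cV[R]_m; closedness, compactness and interiors refer to the
   library topology on matrices (the one of the max norm), which is the usual
   topology of R^m.  The norm used to measure distances is a separate function
   N : 'cV[R]_n -> R subject to [is_norm]. *)

Definition dotv (R : realType) (m : nat) (u v : 'cV[R]_m) : R :=
  (u^T *m v) 0 0.

Definition is_norm (R : realType) (m : nat) (N : 'cV[R]_m -> R) : Prop :=
  [/\ forall x, 0 <= N x,
      forall x, N x = 0 -> x = 0,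
      forall (a : R) x, N (a *: x) = `|a| * N x
    & forall x y, N (x + y) <= N x + N y].

(* The supremum is a maximum whenever N is a norm. *)
Definition dual_norm (R : realType) (m : nat) (N : 'cV[R]_m -> R)
    (z : 'cV[R]_m) : R :=
  sup [set dotv z y | y in [set y | N y <= 1]].

Definition is_cone (R : realType) (m : nat) (K : set 'cV[R]_m) : Prop :=
  K !=set0 /\ forall (a : R) s, 0 <= a -> K s -> K (a *: s).

Definition pointed (R : realType) (m : nat) (K : set 'cV[R]_m) : Prop :=
  K `&` [set - s | s in K] `<=` [set 0].

Definition closed_convex_pointed_cone (R : realType) (m : nat)
    (K : set 'cV[R]_m) : Prop :=
  [/\ is_cone K, closed K, convex_set K & pointed K].

Definition cone_le (R : realType) (m : nat) (K : set 'cV[R]_m)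
    (a c : 'cV[R]_m) : Prop :=
  K (c - a).

Definition dual_cone (R : realType) (m : nat) (K : set 'cV[R]_m) :
    set 'cV[R]_m :=
  [set lam | forall s, K s -> 0 <= dotv lam s].

Definition conic_set (R : realType) (m n : nat) (K : set 'cV[R]_m)
    (A : 'M[R]_(m, n)) (b : 'cV[R]_m) : set 'cV[R]_n :=
  [set y | cone_le K (A *m y) b].

Definition affine_hull (R : realType) (m : nat) (S : set 'cV[R]_m) :
    set 'cV[R]_m :=
  [set y | exists (k : nat) (c : 'I_k -> R) (p : 'I_k -> 'cV[R]_m),
     [/\ forall i, S (p i), \sum_(i < k) c i = 1
       & y = \sum_(i < k) c i *: p i]].

Definition relint (R : realType) (m : nat) (S : set 'cV[R]_m) :
    set 'cV[R]_m :=
  [set y | S y /\ \forall z \near y, affine_hull S z -> S z].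

Definition translate (R : realType) (m : nat) (E : set 'cV[R]_m)
    (t : 'cV[R]_m) : set 'cV[R]_m :=
  [set e + t | e in E].

(* [inf] is the real-valued infimum, with junk value 0 on the empty set.  The
   set of admissible t is nonempty if E and Obs are nonempty (for [dist])
   and, in dimension at least 1, bounded (for [pen]). *)
Definition dist (R : realType) (m : nat) (N : 'cV[R]_m -> R)
    (E Obs : set 'cV[R]_m) : R :=
  inf [set N t | t in [set t | translate E t `&` Obs !=set0]].

Definition pen (R : realType) (m : nat) (N : 'cV[R]_m -> R)
    (E Obs : set 'cV[R]_m) : R :=
  inf [set N t | t in [set t | translate E t `&` Obs = set0]].

Definition sd (R : realType) (m : nat) (N : 'cV[R]_m -> R)
    (E Obs : set 'cV[R]_m) : R :=
  dist N E Obs - pen N E Obs.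

Definition is_rotation (R : realType) (n : nat) (Q : 'M[R]_n) : Prop :=
  Q^T *m Q = 1%:M /\ \det Q = 1.

Fixpoint is_Ck (R : realType) (U V : normedModType R) (k : nat) (f : U -> V) :
    Prop :=
  if k is k'.+1 then
    continuous f /\
    forall v : U, (forall x, derivable f x v) /\ is_Ck k' (fun x => 'D_v f x)
  else continuous f.

Definition smooth (R : realType) (U V : normedModType R) (f : U -> V) : Prop :=
  forall k, is_Ck k f.

(* Main.v *)
Require Import Defs.
From HB Require Import structures.
From mathcomp Require Import all_boot all_order all_algebra.
From mathcomp Require Import all_classical all_reals all_analysis.
From mathcomp Require Import ring lra.

Import Order.TTheory GRing.Theory Num.Theory.
Import numFieldNormedType.Exports.

Local Open Scope classical_set_scope.
Local Open Scope ring_scope.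

(** Let v range over the vectors of dual norm 1.  For convex compact sets E and Obs,
    sd (E, Obs) is the largest value over v of the gap
      min_E <v, .> - max_Obs <v, .>.
    When the sets are disjoint this is the duality between the distance of 0 to
    the convex set D = Obs - E and its supporting hyperplanes.  When they meet,
    the penetration is the distance of 0 to the complement of D, and a
    translation outside D is cut off from D by a hyperplane
    ([sd_ge_gap], [sd_gap]).

    For a fixed v, conic duality turns the two extrema into multipliers: an
    upper bound of <v, .> on Obs is b^T lam with A^T lam = v and lam in the dual
    of K, and an upper bound of <- R^T v, .> on B is g^T mu with
    G^T mu = - R^T v.  Nothing in the hypotheses is a Slater condition for the
    conic representations, and the dual optimum need not be attained.  Two facts
    replace it.  The strict inequality of the theorem leaves room to relax the
    extrema by a small eps; and in [conic_duality] a bound that holds strictly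
    on a nonempty bounded feasible set always has a multiplier, because the only
    obstruction would be a recession direction of that set.

    Everything rests on one separation theorem, [weak_separation]: in R^m a point
    outside a convex set, closed or not, is weakly separated from it by a nonzero
    linear form.  Since the set need not be closed, it applies to the
    images of dual cones, which are not closed in general, and it also shows
    that linear forms are bounded on the unit ball of an arbitrary norm
    ([norm_ball_bounded]), which is what makes the dual norm meaningful. *)

(** * The scalar product *)

Section DotProduct.
Context {R : realType} {m : nat}.
Implicit Types (u v w : 'cV[R]_m) (a : R).

Lemma dotvE u v : dotv u v = \sum_i u i 0 * v i 0.
Proof. by rewrite /dotv mxE; apply: eq_bigr => i _; rewrite mxE. Qed.

Lemma dotvC u v : dotv u v = dotv v u.
Proof. by rewrite !dotvE; apply: eq_bigr => i _; rewrite mulrC. Qed.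

Lemma dotvDr u v w : dotv u (v + w) = dotv u v + dotv u w.
Proof. by rewrite /dotv mulmxDr mxE. Qed.

Lemma dotvZr u a v : dotv u (a *: v) = a * dotv u v.
Proof. by rewrite /dotv -scalemxAr mxE. Qed.

Lemma dotvNr u v : dotv u (- v) = - dotv u v.
Proof. by rewrite -scaleN1r dotvZr mulN1r. Qed.

Lemma dotvBr u v w : dotv u (v - w) = dotv u v - dotv u w.
Proof. by rewrite dotvDr dotvNr. Qed.

Lemma dotv0r u : dotv u 0 = 0.
Proof. by rewrite /dotv mulmx0 mxE. Qed.

Lemma dotvDl u v w : dotv (u + v) w = dotv u w + dotv v w.
Proof. by rewrite dotvC dotvDr !(dotvC w). Qed.

Lemma dotvZl a u v : dotv (a *: u) v = a * dotv u v.
Proof. by rewrite dotvC dotvZr (dotvC v). Qed.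

Lemma dotvNl u v : dotv (- u) v = - dotv u v.
Proof. by rewrite dotvC dotvNr (dotvC v). Qed.

Lemma dotvBl u v w : dotv (u - v) w = dotv u w - dotv v w.
Proof. by rewrite dotvDl dotvNl. Qed.

Lemma dotv0l u : dotv 0 u = 0.
Proof. by rewrite dotvC dotv0r. Qed.

Lemma dotv_gt0 u : u != 0 -> 0 < dotv u u.
Proof.
move=> u0; rewrite dotvE lt_neqAle sumr_ge0 ?andbT; last first.
  by move=> i _; rewrite -expr2 sqr_ge0.
apply: contra u0; rewrite eq_sym psumr_eq0; last first.
  by move=> i _; rewrite -expr2 sqr_ge0.
move=> /allP h; apply/eqP/matrixP => i j; rewrite ord1 mxE.
by have := h i (mem_index_enum _); rewrite mulf_eq0 orbb => /eqP.
Qed.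

End DotProduct.

Lemma dotv_trmx {R : realType} {p q : nat} (M : 'M[R]_(p, q)) u v :
  dotv (M^T *m u) v = dotv u (M *m v).
Proof. by rewrite /dotv trmx_mul trmxK mulmxA. Qed.

Lemma dotv_col_mx {R : realType} {m : nat} (a b : R) (u v : 'cV[R]_m) :
  dotv (col_mx a%:M u) (col_mx b%:M v) = a * b + dotv u v.
Proof.
rewrite /dotv tr_col_mx mul_row_col tr_scalar_mx -scalar_mxM !mxE.
by rewrite eqxx mulr1n.
Qed.

Lemma col_mx_scalarK {R : realType} {m : nat} (z : 'cV[R]_(1 + m)) :
  col_mx (z 0 0)%:M (dsubmx z) = z.
Proof.
rewrite -[RHS](vsubmxK z); congr col_mx.
apply/matrixP => i j; rewrite !mxE !ord1 eqxx mulr1n; congr (z _ _).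
exact/val_inj.
Qed.

(** * Separation of a point from a convex set *)

Lemma convex_setP {R : realType} {m : nat} (C : set 'cV[R]_m) :
  convex_set C <-> (forall x y (a : R), 0 <= a -> a <= 1 -> C x -> C y ->
    C (a *: x + (1 - a) *: y)).
Proof.
split=> [cC x y a a0 a1 Cx Cy|cC x y a /set_mem Cx /set_mem Cy].
  by have := cC x y (Itv01 a0 a1); rewrite !inE; exact.
by apply/mem_set; exact: cC.
Qed.

Lemma convex_setB {R : realType} {m : nat} (C D : set 'cV[R]_m) :
  convex_set C -> convex_set D -> convex_set [set x - y | x in C & y in D].
Proof.
move=> /convex_setP cC /convex_setP cD; apply/convex_setP.
move=> _ _ a a0 a1 [x Cx [y Dy <-]] [x' Cx' [y' Dy' <-]].
exists (a *: x + (1 - a) *: x'); first exact: cC.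
exists (a *: y + (1 - a) *: y'); first exact: cD.
by rewrite !scalerBr opprD addrACA.
Qed.

Lemma convex_set1 {R : realType} {m : nat} (p : 'cV[R]_m) :
  convex_set [set p].
Proof.
apply/convex_setP => _ _ a _ _ -> ->.
by rewrite /= -scalerDl addrC subrK scale1r.
Qed.

(** Induction on the dimension, as in Fourier-Motzkin elimination.  A form w that
    is nonnegative on the slice of C by the hyperplane where the first
    coordinate vanishes extends to C as soon as the coefficient of that
    coordinate lies between the constraints coming from the two sides.  These
    constraints are compatible because a segment joining the two sides crosses
    the slice.  If C lies on one side, the first coordinate itself separates. *)
Lemma weak_separation0 {R : realType} {m : nat} (C : set 'cV[R]_m) :
  convex_set C -> C !=set0 -> ~ C 0 ->
  exists2 w, w != 0 & forall z, C z -> 0 <= dotv w z.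
Proof.
elim: m C => [|m IHm] C cC [z0 Cz0] C0; first by case: C0; rewrite -(flatmx0 z0).
have colE (c : R) : col_mx c%:M 0 = 0 :> 'cV[R]_(1 + m) -> c = 0.
  by move=> /(congr1 (dotv (col_mx 1%:M 0))); rewrite dotv_col_mx !dotv0r; lra.
have {}cC : forall x y (a : R), 0 <= a -> a <= 1 -> C x -> C y ->
  C (a *: x + (1 - a) *: y) by exact/convex_setP.
(* Points of C are written as a first coordinate c followed by y. *)
pose P (c : R) (y : 'cV[R]_m) := C (col_mx c%:M y).
have cP c d y z a : 0 <= a -> a <= 1 -> P c y -> P d z ->
    P (a * c + (1 - a) * d) (a *: y + (1 - a) *: z).
  move=> a0 a1 Py Pz; have := cC _ _ _ a0 a1 Py Pz.
  rewrite !(@scale_col_mx _ 1 m) !scale_scalar_mx (@add_col_mx _ 1 m).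
  by rewrite -(raddfD (@scalar_mx R 1)).
have zK (z : 'cV[R]_(1 + m)) := col_mx_scalarK z.
have CP z : C z -> P (z 0 0) (@dsubmx R 1 m 1 z) by rewrite /P zK.
have sepP c w : col_mx c%:M w != 0 -> (forall b y, P b y -> 0 <= c * b + dotv w y) ->
    exists2 w0, w0 != 0 & forall z, C z -> 0 <= dotv w0 z.
  move=> n0 h; exists (col_mx c%:M w) => // z /CP /h.
  by rewrite -{3}(zK z) (@dotv_col_mx R m).
have [[cp [yp [cp0 Pp]]]|nop] := pselect (exists c y, 0 < c /\ P c y); last first.
  apply: (sepP (-1) 0) => [|b y Pb].
    by apply/eqP => /colE; lra.
  rewrite dotv0l; suff : b <= 0 by lra.
  by rewrite leNgt; apply/negP => b0; apply: nop; exists b, y.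
have [[cn [yn [cn0 Pn]]]|non] := pselect (exists c y, c < 0 /\ P c y); last first.
  apply: (sepP 1 0) => [|b y Pb].
    by apply/eqP => /colE; lra.
  rewrite dotv0l; suff : 0 <= b by lra.
  by rewrite leNgt; apply/negP => b0; apply: non; exists b, y.
have cross c d y z : 0 < c -> d < 0 -> P c y -> P d z ->
    P 0 (((- d) / (c - d)) *: y + (1 - (- d) / (c - d)) *: z).
  move=> c0 d0 Pc Pd.
  have cd : 0 < c - d by lra.
  have := cP _ _ _ _ ((- d) / (c - d)) _ _ Pc Pd.
  rewrite divr_ge0 ?ler_pdivrMr ?ltW ?oppr_gt0 ?mul1r//; last lra.
  suff -> : - d / (c - d) * c + (1 - - d / (c - d)) * d = 0 by apply.
  by field; lra.
have [] := IHm (P 0).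
- apply/convex_setP => x y a a0 a1 Px Py.
  by have := cP _ _ _ _ _ a0 a1 Px Py; rewrite !mulr0 addr0.
- by eexists; apply: (cross _ _ _ _ cp0 cn0 Pp Pn).
- by rewrite /P => C00; apply: C0; move: C00; rewrite raddf0 col_mx0.
move=> w w0 hw.
have crossw c d y z : 0 < c -> d < 0 -> P c y -> P d z ->
    dotv w z / d <= dotv w y / c.
  move=> c0 d0 Pc Pd.
  have := hw _ (cross _ _ _ _ c0 d0 Pc Pd).
  rewrite dotvDr !dotvZr.
  have cd : 0 < c - d by lra.
  have -> : - d / (c - d) * dotv w y + (1 - - d / (c - d)) * dotv w z =
     (c * dotv w z - d * dotv w y) / (c - d) by field; lra.
  rewrite pmulr_lge0 ?invr_gt0// => h.
  rewrite ler_pdivlMr// mulrAC ler_ndivrMr//; lra.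
(* The first coefficient of the form sought is minus the supremum of S. *)
pose S : set R := [set s | exists c y, [/\ c < 0, P c y & s = dotv w y / c]].
have ubS c y : 0 < c -> P c y -> ubound S (dotv w y / c).
  by move=> c0 Pc _ [d [z [d0 Pd ->]]]; apply: crossw.
have S0 : S !=set0 by exists (dotv w yn / cn), cn, yn.
apply: (sepP (- sup S) w).
  apply/eqP => h; have := dotv_gt0 _ w0.
  have := congr1 (dotv (col_mx 0%:M w)) h.
  by rewrite dotv_col_mx dotv0r; lra.
move=> b y Pb; case: (ltgtP b 0) => b0.
- have : dotv w y / b <= sup S.
    by apply: ub_le_sup; [exists (dotv w yp / cp); exact: ubS|exists b, y].
  by rewrite ler_ndivrMr//; lra.
- have : sup S <= dotv w y / b by apply: ge_sup => //; exact: ubS.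
  by rewrite ler_pdivlMr//; lra.
- by rewrite b0 mulr0 add0r; apply: hw; rewrite -b0.
Qed.

Lemma weak_separation {R : realType} {m : nat} (C : set 'cV[R]_m) p :
  convex_set C -> C !=set0 -> ~ C p ->
  exists2 w, w != 0 & forall z, C z -> dotv w p <= dotv w z.
Proof.
move=> cC [z0 Cz0] Cp.
have [|||w w0 hw] := @weak_separation0 R m [set x - y | x in C & y in [set p]].
- exact/convex_setB/convex_set1.
- by exists (z0 - p), z0 => //; exists p.
- by move=> [z Cz [_ -> /eqP]]; rewrite subr_eq0 => /eqP zp; rewrite zp in Cz.
exists w => // z Cz; have : 0 <= dotv w (z - p).
  by apply: hw; exists z => //; exists p.
by rewrite dotvBr subr_ge0.
Qed.

(** * Norms and dual norms *)

Section Norms.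
Context {R : realType} {m : nat} (N : 'cV[R]_m -> R).
Context (normN : is_norm N).

Lemma norm_ge0 x : 0 <= N x. Proof. by case: normN. Qed.

Lemma norm_eq0 x : N x = 0 -> x = 0. Proof. by case: normN => _ + _ _; apply. Qed.

Lemma normZ (a : R) x : N (a *: x) = `|a| * N x. Proof. by case: normN. Qed.

Lemma ler_normN x y : N (x + y) <= N x + N y. Proof. by case: normN. Qed.

Lemma norm0 : N 0 = 0. Proof. by rewrite -(scale0r 0) normZ normr0 mul0r. Qed.

Lemma normNN x : N (- x) = N x.
Proof. by rewrite -scaleN1r normZ normrN1 mul1r. Qed.

Lemma norm_gt0 x : x != 0 -> 0 < N x.
Proof.
by move=> x0; rewrite lt_neqAle norm_ge0 andbT eq_sym; apply: contra x0 => /eqP/norm_eq0/eqP.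
Qed.

Lemma norm_conv_le x y (a : R) : 0 <= a -> a <= 1 ->
  N (a *: x + (1 - a) *: y) <= a * N x + (1 - a) * N y.
Proof.
move=> a0 a1; apply: le_trans (ler_normN _ _) _.
by rewrite !normZ !ger0_norm ?subr_ge0.
Qed.

Lemma norm_ball_convex (r : R) : convex_set [set x | N x <= r].
Proof.
apply/convex_setP => x y a a0 a1 /= xr yr.
by have := norm_conv_le x y a a0 a1; nra.
Qed.

Lemma norm_open_ball_convex (r : R) : convex_set [set x | N x < r].
Proof.
apply/convex_setP => x y a a0 a1 /= xr yr.
apply: le_lt_trans (norm_conv_le x y a a0 a1) _.
have [->|a'] := eqVneq a 0; first lra.
have : 0 < a by rewrite lt_neqAle eq_sym a'.
by nra.
Qed.

(** The forms that are bounded on the unit ball make up a linear subspace F.  If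
    F were proper, some y <> 0 would be orthogonal to F.  But a form separating
    y from the open ball of radius N y belongs to F, hence vanishes at y; being
    of constant sign on a symmetric ball, it would then be zero. *)
Lemma norm_ball_bounded w : exists M, forall y, N y <= 1 -> dotv w y <= M.
Proof.
pose F : set 'cV[R]_m := [set w | exists M, forall y, N y <= 1 -> dotv w y <= M].
have FZ (a : R) f : F f -> F (a *: f).
  move=> [M hM]; exists (`|a| * M) => y y1; rewrite dotvZl.
  have [a0|a0] := leP 0 a; first by rewrite ger0_norm//; apply: ler_wpM2l => //; exact: hM.
  have : dotv f (- y) <= M by apply: hM; rewrite normNN.
  by rewrite dotvNr ltr0_norm//; nra.
have cF : convex_set F.
  apply/convex_setP => f g a a0 a1 /(FZ a)[M hM] /(FZ (1 - a))[M' hM'].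
  by exists (M + M') => y y1; rewrite dotvDl lerD ?hM ?hM'.
apply: contrapT => nFw.
have [|y y0 hy] := weak_separation _ _ cF _ nFw.
  by exists 0, 0 => y _; rewrite dotv0l.
have yF f : F f -> dotv y f = 0.
  move=> Ff; apply/eqP; apply/negPn/negP => yf.
  have := hy _ (FZ ((dotv y w - 1) / dotv y f) _ Ff).
  by rewrite dotvZr divfK//; lra.
have [|||u u0 hu] := weak_separation [set z | N z < N y] y.
- exact: norm_open_ball_convex.
- by exists 0; rewrite /= norm0 norm_gt0.
- by rewrite /= ltxx.
have Ny := norm_gt0 _ y0.
have Fu : F (- u).
  exists (- (2 * dotv u y / N y)) => z z1.
  have : dotv u y <= dotv u ((N y / 2) *: z).
    by apply: hu; rewrite /= normZ ger0_norm; nra.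
  rewrite dotvZr dotvNl lerN2 ler_pdivrMr//; lra.
have uy : dotv u y = 0 by apply/eqP; rewrite -oppr_eq0 -dotvNl dotvC yF.
have Nu := norm_gt0 _ u0.
have : dotv u y <= dotv u (- (N y / (2 * N u)) *: u).
  apply: hu; rewrite /= normZ normrN ger0_norm; last by rewrite divr_ge0; lra.
  by rewrite invfM mulrA divfK; lra.
rewrite uy dotvZr; have := dotv_gt0 _ u0.
have : 0 < N y / (2 * N u) by rewrite divr_gt0; lra.
by nra.
Qed.

Lemma dual_norm_has_sup w : has_sup [set dotv w y | y in [set y | N y <= 1]].
Proof.
split; first by exists (dotv w 0), 0 => //=; rewrite norm0.
by have [M hM] := norm_ball_bounded w; exists M => _ [y y1 <-]; exact: hM.
Qed.

Lemma dual_norm_ub w y : N y <= 1 -> dotv w y <= dual_norm N w.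
Proof.
by move=> y1; apply: (sup_upper_bound (dual_norm_has_sup w)); exists y.
Qed.

Lemma dual_norm_le w M : (forall y, N y <= 1 -> dotv w y <= M) ->
  dual_norm N w <= M.
Proof.
move=> hM; apply: ge_sup; first by case: (dual_norm_has_sup w).
by move=> _ [y y1 <-]; exact: hM.
Qed.

Lemma dual_norm_gt w r : r < dual_norm N w -> exists2 y, N y <= 1 & r < dotv w y.
Proof.
move=> rw; apply: contrapT => h; move: rw; rewrite ltNge => /negP; apply.
apply: dual_norm_le => y y1; rewrite leNgt; apply/negP => ry.
by apply: h; exists y.
Qed.

Lemma dual_norm_holder w y : dotv w y <= dual_norm N w * N y.
Proof.
have [->|y0] := eqVneq y 0; first by rewrite dotv0r norm0 mulr0.
have Ny := norm_gt0 _ y0.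
rewrite -ler_pdivrMr// mulrC -dotvZr; apply: dual_norm_ub.
by rewrite normZ gtr0_norm ?invr_gt0// mulVf ?lt0r_neq0.
Qed.

Lemma dual_normN w : dual_norm N (- w) = dual_norm N w.
Proof.
suff le_dualN v : dual_norm N (- v) <= dual_norm N v.
  by apply/eqP; rewrite eq_le le_dualN -{1}(opprK w) le_dualN.
by apply: dual_norm_le => y y1; rewrite dotvNl -dotvNr dual_norm_ub// normNN.
Qed.

Lemma dual_norm_gt0 w : w != 0 -> 0 < dual_norm N w.
Proof.
move=> w0; have := dual_norm_holder w w; have := dotv_gt0 _ w0.
by have := norm_gt0 _ w0; nra.
Qed.

Lemma dual_norm_normalize w : w != 0 ->
  dual_norm N ((dual_norm N w)^-1 *: w) = 1.
Proof.
move=> w0; have D0 := dual_norm_gt0 _ w0; apply/eqP; rewrite eq_le.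
apply/andP; split.
  apply: dual_norm_le => y y1.
  by rewrite dotvZl mulrC ler_pdivrMr// mul1r dual_norm_ub.
rewrite -[leLHS](mulVf (lt0r_neq0 D0)) mulrC ler_pdivrMr//.
apply: dual_norm_le => y y1; rewrite -ler_pdivrMr// mulrC -dotvZl.
exact: dual_norm_ub.
Qed.

Lemma normalized_separation (C : set 'cV[R]_m) p :
  convex_set C -> C !=set0 -> ~ C p ->
  exists2 v, dual_norm N v = 1 & forall z, C z -> dotv v p <= dotv v z.
Proof.
move=> cC C0 Cp; have [w w0 hw] := weak_separation _ _ cC C0 Cp.
exists ((dual_norm N w)^-1 *: w); first exact: dual_norm_normalize.
by move=> z /hw; rewrite !dotvZl ler_pM2l// invr_gt0 dual_norm_gt0.
Qed.

(** C misses the closed ball of radius r, so 0 is outside C minus that ball.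
    The largest value on the ball of the separating form is r times its dual
    norm. *)
Lemma distance_separation (C : set 'cV[R]_m) (r : R) :
  convex_set C -> C !=set0 -> 0 <= r -> (forall z, C z -> r < N z) ->
  exists2 v, dual_norm N v = 1 & forall z, C z -> r <= dotv v z.
Proof.
move=> cC [z0 Cz0] r0 hC.
have [|||v v1 hv] := normalized_separation [set x - y | x in C & y in [set y | N y <= r]] 0.
- exact/convex_setB/norm_ball_convex.
- by exists (z0 - 0), z0 => //; exists 0 => //=; rewrite norm0.
- move=> [z Cz [y yr /eqP]]; rewrite subr_eq0 => /eqP zy.
  by have := hC _ Cz; rewrite zy ltNge => /negP; apply.
exists v => // z Cz.
have vzy y : N y <= r -> dotv v y <= dotv v z.
  move=> yr; have : dotv v 0 <= dotv v (z - y) by apply: hv; exists z => //; exists y.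
  by rewrite dotv0r dotvBr subr_ge0.
rewrite -[r]mulr1 -v1; have [r00|r00] := eqVneq r 0.
  by rewrite r00 mul0r -(dotv0r v) vzy // norm0.
have {}r0 : 0 < r by rewrite lt_neqAle eq_sym r00.
rewrite mulrC -ler_pdivlMr//; apply: dual_norm_le => y y1.
by rewrite ler_pdivlMr// mulrC -dotvZr vzy// normZ gtr0_norm// ler_piMr// ltW.
Qed.

End Norms.

(** * Compact sets and closed cones *)

Lemma mx_norm_is_norm {R : realType} {m : nat} :
  is_norm (fun x : 'cV[R]_m => `|x|).
Proof.
split=> [x|x|a x|x y]; [exact: normr_ge0|exact: normr0_eq0|exact: normrZ|exact: ler_normD].
Qed.

Lemma compact_dotv_bounded {R : realType} {m : nat} (C : set 'cV[R]_m) :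
  compact C -> forall v, exists M, forall y, C y -> dotv v y <= M.
Proof.
move=> /compact_bounded [M [_ hM]] v.
exists (dual_norm (fun x : 'cV[R]_m => `|x|) v * (M + 1)) => y Cy.
apply: le_trans (dual_norm_holder _ mx_norm_is_norm v y) _.
rewrite ler_wpM2l//; last by apply: hM => //; lra.
by rewrite -(dotv0r v) dual_norm_ub ?normr0//; exact: mx_norm_is_norm.
Qed.

(** The nontrivial half of the bipolar theorem: a point outside K is at positive
    distance from K, and a form that separates it strictly from a cone must be
    nonnegative on the cone. *)
Lemma dual_cone_closed_bipolar {R : realType} {m : nat} (K : set 'cV[R]_m) x :
  is_cone K -> closed K -> convex_set K ->
  (forall lam, dual_cone K lam -> 0 <= dotv lam x) -> K x.
Proof.
move=> [[k0 Kk0] KZ] clK cK hx; apply: contrapT => nKx.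
have : nbhs x (~` K) by apply: open_nbhs_nbhs; split => //; exact: closed_openC.
move=> /nbhs_ballP [e /= e0 he].
have [||||v _ hv] := distance_separation _ mx_norm_is_norm
    [set k - y | k in K & y in [set x]] (e / 2).
- exact/convex_setB/convex_set1.
- by exists (k0 - x), k0 => //; exists x.
- lra.
- move=> _ [k Kk [_ -> <-]]; rewrite ltNge; apply/negP => ke.
  apply: (he k) => //; rewrite -ball_normE /= distrC; lra.
have {}hv k : K k -> e / 2 + dotv v x <= dotv v k.
  by move=> Kk; rewrite -lerBrDr -dotvBr; apply: hv; exists k => //; exists x.
have vx : dotv v x < 0.
  have : e / 2 + dotv v x <= dotv v 0.
    by apply: hv; rewrite -(scale0r k0); exact: KZ.
  by rewrite dotv0r; lra.
suff /hx : dual_cone K v by lra.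
move=> k Kk; rewrite leNgt; apply/negP => vk.
(* If v is negative at k, this multiple of k takes the value <v, x>. *)
have := hv _ (KZ (dotv v x / dotv v k) _ _ Kk).
rewrite dotvZr divfK; last by rewrite lt_eqF.
have -> : 0 <= dotv v x / dotv v k by rewrite -mulrNN -invrN divr_ge0; lra.
by move=> /(_ isT); lra.
Qed.

(** * Conic duality without a constraint qualification *)

(** The pairs (<b, lam> + s, A^T lam), with lam in the dual cone and s >= 0, form
    a convex set C.  If (beta, v) is outside C, a form (tau, w) separates it from
    C, with tau >= 0; the bipolar theorem gives A w + tau b in K.  For
    tau > 0 the point - w / tau is feasible and violates the strict bound.  For
    tau = 0 every y - s w with y feasible and s >= 0 is feasible, against
    boundedness. *)
Lemma conic_duality {R : realType} {l n : nat} (K : set 'cV[R]_l)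
    (A : 'M[R]_(l, n)) (b : 'cV[R]_l) (v : 'cV[R]_n) (beta : R) :
  is_cone K -> closed K -> convex_set K ->
  conic_set K A b !=set0 ->
  (forall w, exists M, forall y, conic_set K A b y -> dotv w y <= M) ->
  (forall y, conic_set K A b y -> dotv v y < beta) ->
  exists lam, [/\ dual_cone K lam, A^T *m lam = v & dotv b lam <= beta].
Proof.
move=> coneK clK cK [y0 Oy0] bndO hv.
pose C : set 'cV[R]_(1 + n) := [set z | exists lam s,
  [/\ dual_cone K lam, 0 <= s & z = col_mx (dotv b lam + s)%:M (A^T *m lam)]].
have [[lam [s [Klam s0 /eq_col_mx[/matrixP/(_ 0 0) eb ev]]]]|nC] :=
    pselect (C (col_mx beta%:M v)).
  exists lam; split => //; move: eb; rewrite !mxE eqxx !mulr1n; lra.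
have cC : convex_set C.
  apply/convex_setP => _ _ a a0 a1 [lam [s [Kl s0 ->]]] [mu [r [Km r0 ->]]].
  exists (a *: lam + (1 - a) *: mu), (a * s + (1 - a) * r); split.
  - move=> k Kk; rewrite dotvDl !dotvZl.
    by have := Kl _ Kk; have := Km _ Kk; nra.
  - nra.
  rewrite !scale_col_mx !scale_scalar_mx add_col_mx -(raddfD (@scalar_mx R 1)).
  rewrite mulmxDr -!scalemxAr dotvDr !dotvZr; congr col_mx; congr scalar_mx.
  ring.
have K0 : dual_cone K 0 by move=> k _; rewrite dotv0l.
have KZ lam a : 0 <= a -> dual_cone K lam -> dual_cone K (a *: lam).
  by move=> a0 Kl k Kk; rewrite dotvZl mulr_ge0// Kl.
have [|W W0 hW] := weak_separation _ _ cC _ nC.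
  by exists (col_mx (dotv b 0 + 0)%:M (A^T *m 0)), 0, 0.
have {W0 hW} [tau [w [tw0 htw]]] : exists (tau : R) (w : 'cV[R]_n), (tau != 0 \/ w != 0) /\
    forall lam s, dual_cone K lam -> 0 <= s ->
      tau * beta + dotv w v <= tau * (dotv b lam + s) + dotv w (A^T *m lam).
  exists (W 0 0), (@dsubmx R 1 n 1 W); split.
    apply/orP; rewrite -negb_and; apply: contra W0 => /andP[/eqP t0 /eqP w0].
    by rewrite -(col_mx_scalarK W) t0 w0 raddf0 col_mx0.
  move=> lam s Kl s0; rewrite -!dotv_col_mx col_mx_scalarK.
  by apply: hW; exists lam, s.
have tb : tau * beta + dotv w v <= 0.
  by have := htw _ _ K0 (lexx 0); rewrite mulmx0 !dotv0r; lra.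
have htau : 0 <= tau.
  rewrite leNgt; apply/negP => tau0.
  (* For this s the right-hand side is tau plus the left-hand side. *)
  have s0 : 0 <= 1 + (tau * beta + dotv w v) / tau.
    by rewrite addr_ge0// -mulrNN -invrN mulr_ge0 ?invr_ge0; lra.
  have := htw _ _ K0 s0; rewrite mulmx0 !dotv0r add0r addr0 mulrDr mulr1.
  by rewrite mulrCA divff ?mulr1 ?lt_eqF//; lra.
have Kw : K (A *m w + tau *: b).
  apply: dual_cone_closed_bipolar => // lam Kl; rewrite leNgt; apply/negP => neg.
  pose q := dotv lam (A *m w + tau *: b).
  have qE a : tau * (dotv b (a *: lam) + 0) + dotv w (A^T *m (a *: lam)) = a * q.
    rewrite addr0 -scalemxAr !dotvZr (dotvC w) dotv_trmx /q dotvDr dotvZr.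
    by rewrite (dotvC b); ring.
  (* Scaling lam by this factor brings q strictly below the lower bound. *)
  have s0 : 0 <= 1 + (tau * beta + dotv w v) / q.
    by rewrite addr_ge0// -mulrNN -invrN mulr_ge0 ?invr_ge0 /q; lra.
  have := htw _ _ (KZ _ _ s0 Kl) (lexx 0).
  by rewrite qE mulrDl mul1r divfK ?lt_eqF//; rewrite -/q in neg; lra.
have [tau0|tau0] := eqVneq tau 0.
  have {tw0} w0 : w != 0 by case: tw0; rewrite ?tau0 ?eqxx.
  have [M hM] := bndO (- w).
  have ray s : 0 <= s -> conic_set K A b (y0 - s *: w).
    move=> s0; have {}Kw : K (A *m w) by move: Kw; rewrite tau0 scale0r addr0.
    rewrite /conic_set /= /cone_le mulmxBr -scalemxAr opprB addrA addrAC.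
    (* A sum of two points of a convex cone is twice their midpoint. *)
    have -> : b - A *m y0 + s *: (A *m w) =
       2 *: (2^-1 *: (b - A *m y0) + (1 - 2^-1) *: (s *: (A *m w))).
      by rewrite scalerDr !scalerA divff// scale1r; congr (_ + _ *: _); field.
    have [_ KZ'] := coneK; apply: (KZ') => //.
    by have /convex_setP := cK; apply; [lra|lra|exact: Oy0|exact: KZ'].
  have ww := dotv_gt0 _ w0.
  (* Along the ray, <- w, .> grows at rate <w, w>: this s makes it exceed M. *)
  have s0 : 0 <= (`|M| + 1 + `|dotv w y0|) / dotv w w by rewrite divr_ge0// ltW.
  have := hM _ (ray _ s0); rewrite dotvBr !dotvNl dotvZr divfK ?gt_eqF//.
  by have := ler_norm M; have := ler_norm (dotv w y0); lra.
have {}htau : 0 < tau by rewrite lt_neqAle eq_sym tau0.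
have : conic_set K A b (- tau^-1 *: w).
  rewrite /conic_set /= /cone_le.
  have -> : b - A *m (- tau^-1 *: w) = tau^-1 *: (A *m w + tau *: b).
    rewrite -scalemxAr scaleNr opprK scalerDr scalerA mulVf// scale1r.
    by rewrite addrC.
  by case: coneK => _; apply => //; rewrite invr_ge0 ltW.
move=> /hv; rewrite dotvZr mulNr (dotvC v) => h.
have : tau * (- (tau^-1 * dotv w v)) < tau * beta by rewrite ltr_pM2l.
by rewrite mulrN mulrA mulfV// mul1r; lra.
Qed.

(** * Signed distance as a largest separation gap *)

Section SignedDistance.
Context {R : realType} {m : nat} (N : 'cV[R]_m -> R).
Context (normN : is_norm N).
Context (E Obs : set 'cV[R]_m).
Context (cE : convex_set E) (cO : convex_set Obs).
Context (E0 : E !=set0) (O0 : Obs !=set0).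

Local Notation D := [set q - e | q in Obs & e in E].

Lemma translate_meetP t : (translate E t `&` Obs !=set0) <-> D t.
Proof.
split=> [[_ [[e Ee <-] Oet]]|[q Oq [e Ee <-]]].
  by exists (e + t) => //; exists e => //; rewrite addrAC subrr add0r.
by exists q; split => //; exists e => //; rewrite addrC subrK.
Qed.

Lemma dist_difference : dist N E Obs = inf (N @` D).
Proof.
by rewrite /dist; congr (inf (N @` _)); apply/seteqP; split=> t /translate_meetP.
Qed.

Lemma pen_difference : pen N E Obs = inf (N @` ~` D).
Proof.
rewrite /pen; congr (inf (N @` _)); apply/seteqP; split=> t /=.
  by move=> t0 /translate_meetP; rewrite t0 => -[].
by move=> nD; apply/eqP; apply: contrapT => /negP/set0P/translate_meetP.
Qed.

Lemma norm_image_has_lbound (S : set 'cV[R]_m) : has_lbound (N @` S).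
Proof. by exists 0 => _ [x _ <-]; exact: norm_ge0. Qed.

Lemma inf_norm_eq0 (S : set 'cV[R]_m) : S 0 -> inf (N @` S) = 0.
Proof.
move=> S0; apply/eqP; rewrite eq_le; apply/andP; split.
  by apply: ge_inf; [exact: norm_image_has_lbound|exists 0 => //; exact: norm0].
apply: lb_le_inf; first by exists (N 0), 0.
by move=> _ [x _ <-]; exact: norm_ge0.
Qed.

Lemma sd_disjoint : ~ D 0 -> sd N E Obs = inf (N @` D).
Proof.
by move=> nD; rewrite /sd dist_difference pen_difference (inf_norm_eq0 (~` D))// subr0.
Qed.

Lemma sd_overlap : D 0 -> sd N E Obs = - inf (N @` ~` D).
Proof.
by move=> D0; rewrite /sd dist_difference pen_difference (inf_norm_eq0 D)// sub0r.
Qed.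

Lemma difference_nonempty : D !=set0.
Proof. by case: E0 O0 => e Ee [q Oq]; exists (q - e), q => //; exists e. Qed.

Lemma difference_convex : convex_set D.
Proof. exact: convex_setB. Qed.

(** Weak duality.  When the sets meet, c <= 0, and it must be shown that
    translations of norm arbitrarily close to - c separate them: multiples of a
    vector u of the unit ball at which <v, u> is nearly 1 do. *)
Lemma sd_ge_gap v c : dual_norm N v = 1 ->
  (forall e o, E e -> Obs o -> c <= dotv v (e - o)) -> c <= sd N E Obs.
Proof.
move=> v1 hc.
have {}hc t : D t -> c <= - dotv v t.
  by move=> [q Oq [e Ee <-]]; rewrite -dotvNr opprB; exact: hc.
have [D0|nD0] := pselect (D 0); last first.
  rewrite sd_disjoint//; apply: lb_le_inf.
    by case: difference_nonempty => t Dt; exists (N t), t.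
  move=> _ [t Dt <-]; apply: le_trans (hc t Dt) _.
  rewrite -dotvNr -(normNN _ normN) -[leRHS]mul1r -v1.
  exact: dual_norm_holder.
rewrite sd_overlap// lerNr; have c0 := hc _ D0; rewrite dotv0r oppr0 in c0.
apply/ler_addgt0Pr => eps eps0.
have s0 : 0 < - c + eps by lra.
have : - c / (- c + eps) < dual_norm N v by rewrite v1 ltr_pdivrMr// mul1r; lra.
move=> /(dual_norm_gt _ normN)[u u1]; rewrite ltr_pdivrMr// => hu.
apply: (@le_trans _ _ (N ((- c + eps) *: u))).
  apply: ge_inf; first exact: norm_image_has_lbound.
  by exists ((- c + eps) *: u) => // /hc; rewrite dotvZr; lra.
by rewrite (normZ _ normN) gtr0_norm// ler_piMr// ltW.
Qed.

(** Strong duality.  For sets that meet, separate from D a translation outside D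
    whose norm is slightly above the penetration; for disjoint sets, separate D
    from a ball of radius slightly below the distance.
    A translation outside D is needed because the infimum of the empty set has
    the value 0, which would not be the penetration. *)
Lemma sd_gap d : (exists t, ~ D t) -> d < sd N E Obs ->
  exists v c, [/\ dual_norm N v = 1, d < c
    & forall e o, E e -> Obs o -> c <= dotv v (e - o)].
Proof.
move=> [t0 nDt0]; have [D0|nD0] := pselect (D 0).
  rewrite sd_overlap// ltrNr => pd.
  have [_ [t nDt <-] Nt] : exists2 r, (N @` ~` D) r & r < - d.
    have := @inf_adherent _ (N @` ~` D) (- d - inf (N @` ~` D)).
    rewrite subr_gt0 addrC subrK; apply => //.
    by split; [exists (N t0), t0|exact: norm_image_has_lbound].
  have [v v1 hv] := normalized_separation _ normN _ _ difference_convex difference_nonempty nDt.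
  exists (- v), (- N t); split => [||e o Ee Oo]; [by rewrite dual_normN|lra|].
  have : dotv v t <= dotv v (o - e) by apply: hv; exists o => //; exists e.
  have := dual_norm_holder _ normN v (- t); rewrite v1 mul1r (normNN _ normN).
  by rewrite dotvNl -dotvNr opprB dotvNr; lra.
rewrite sd_disjoint// => dD.
have D0 z : D z -> inf (N @` D) <= N z.
  by move=> Dz; apply: ge_inf; [exact: norm_image_has_lbound|exists z].
have [r [r0 dr hr]] : exists r, [/\ 0 <= r, d < r & forall z, D z -> r < N z].
  have D_ge0 : 0 <= inf (N @` D).
    apply: lb_le_inf; first by case: difference_nonempty => z Dz; exists (N z), z.
    by move=> _ [z _ <-]; exact: norm_ge0.
  (* If the infimum is positive, r is taken strictly below it; if it is 0, then
     r = 0 is allowed because 0 is not in D. *)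
  have [i0|i0] := eqVneq (inf (N @` D)) 0.
    exists 0; split => // [|z Dz]; first lra.
    by apply: norm_gt0 => //; apply: contra_notN nD0 => /eqP <-.
  have {i0} i0 : 0 < inf (N @` D) by rewrite lt_neqAle eq_sym i0.
  exists (Num.max ((inf (N @` D) + d) / 2) (inf (N @` D) / 2)); split.
  - by rewrite le_max; apply/orP; right; lra.
  - by rewrite lt_max; apply/orP; left; lra.
  - by move=> z /D0 Nz; rewrite gt_max; apply/andP; split; lra.
have [v v1 hv] := distance_separation _ normN _ _ difference_convex difference_nonempty r0 hr.
exists (- v), r; split => // [|e o Ee Oo]; first by rewrite dual_normN.
by rewrite dotvNl -dotvNr opprB; apply: hv; exists o => //; exists e.
Qed.

End SignedDistance.

(** * The dual characterization *)

Theorem theorem2 (R : realType) (n l h nx : nat) (n_ge1 : (1 <= n)%N)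
    (N : 'cV[R]_n -> R) (normN : is_norm N)
    (K : set 'cV[R]_l) (coneK : closed_convex_pointed_cone K)
    (intK : interior K !=set0)
    (A : 'M[R]_(l, n)) (b : 'cV[R]_l)
    (Obs : set 'cV[R]_n) (defO : Obs = conic_set K A b)
    (convexO : convex_set Obs) (compactO : compact Obs) (relintO : relint Obs !=set0)
    (Kbar : set 'cV[R]_h) (coneKbar : closed_convex_pointed_cone Kbar)
    (G : 'M[R]_(h, n)) (g : 'cV[R]_h)
    (B : set 'cV[R]_n) (defB : B = conic_set Kbar G g)
    (convexB : convex_set B) (compactB : compact B) (relintB : relint B !=set0)
    (Rot : 'cV[R]_nx -> 'M[R]_n) (t : 'cV[R]_nx -> 'cV[R]_n)
    (smoothRot : smooth Rot) (smootht : smooth t)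
    (rotRot : forall x, is_rotation (Rot x))
    (E : 'cV[R]_nx -> set 'cV[R]_n)
    (defE : forall x, E x = [set Rot x *m y + t x | y in B]) :
  forall (x : 'cV[R]_nx) (d : R),
    sd N (E x) Obs > d <->
    exists (lam : 'cV[R]_l) (mu : 'cV[R]_h),
      [/\ cone_le (dual_cone K) 0 lam /\ cone_le (dual_cone Kbar) 0 mu,
          - dotv g mu + dotv (A *m t x - b) lam > d,
          G^T *m mu + (Rot x)^T *m A^T *m lam = 0
        & dual_norm N (A^T *m lam) = 1].
Proof.
move=> x d; have [y0 [By0 _]] := relintB; have [q0 [Oq0 _]] := relintO.
have EB y : B y -> E x (Rot x *m y + t x) by rewrite defE => By; exists y.
have E0 : E x !=set0 by exists (Rot x *m y0 + t x); exact: EB.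
have O0 : Obs !=set0 by exists q0.
have bndB := compact_dotv_bounded _ compactB.
have bndO := compact_dotv_bounded _ compactO.
have convexE : convex_set (E x).
  rewrite defE; apply/convex_setP => _ _ a a0 a1 [y By <-] [z Bz <-].
  exists (a *: y + (1 - a) *: z); first by have /convex_setP := convexB; exact.
  rewrite mulmxDr -!scalemxAr !scalerDr addrACA -scalerDl.
  by rewrite [a + _]addrC subrK scale1r.
split=> [sd_d|[lam [mu [[]]]]]; last first.
  rewrite /cone_le !subr0 => Klam Kmu gap stationary v1.
  apply: lt_le_trans gap _; apply: sd_ge_gap v1 _ => //.
  move=> e o; rewrite defE defO => -[y By <-] Oo.
  have {}By : 0 <= dotv mu (g - G *m y) by apply: Kmu; rewrite defB in By.
  have {}Oo : 0 <= dotv lam (b - A *m o) by apply: Klam.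
  have RA : (Rot x)^T *m (A^T *m lam) = - (G^T *m mu).
    by apply/eqP; rewrite -addr_eq0 addrC mulmxA stationary.
  rewrite dotvBr dotvDr -dotv_trmx RA dotvNl !dotv_trmx dotvBl (dotvC g).
  by rewrite (dotvC (A *m t x)) (dotvC b); rewrite !dotvBr in By Oo; lra.
(* Obs and E x are bounded in the direction v, so a long translation along v
   pulls them apart. *)
have compl : exists s, ~ [set q - e | q in Obs & e in E x] s.
  pose v : 'cV[R]_n := const_mx 1.
  have v0 : v != 0.
    apply/eqP => /matrixP/(_ (Ordinal n_ge1) 0); rewrite !mxE => /eqP.
    by rewrite oner_eq0.
  have [M hM] := bndO v; have [M' hM'] := bndB (- ((Rot x)^T *m v)).
  exists (((M + M' - dotv v (t x) + 1) / dotv v v) *: v) => -[q Oq [e]].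
  rewrite defE => -[y By <-] /(congr1 (dotv v)).
  rewrite dotvBr dotvDr dotvZr divfK ?lt0r_neq0 ?dotv_gt0//.
  by have := hM _ Oq; have := hM' _ By; rewrite dotvNl dotv_trmx; lra.
have [v [c [v1 dc hc]]] := sd_gap _ normN _ _ convexE convexO E0 O0 _ compl sd_d.
pose S := [set dotv v o | o in Obs].
have ubS : has_ubound S.
  by have [M hM] := bndO v; exists M => _ [q Oq <-]; exact: hM.
have gapE y : B y -> c + sup S <= dotv v (Rot x *m y + t x).
  move=> By; rewrite -lerBrDl; apply: ge_sup; first by exists (dotv v q0), q0.
  by move=> _ [q Oq <-]; have := hc _ _ (EB _ By) Oq; rewrite dotvBr; lra.
(* Each of the two strict bounds costs one eps, which leaves d + eps. *)
pose eps := (c - d) / 3; have eps0 : 0 < eps by rewrite /eps; lra.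
case: coneK => coneK clK cK _; case: coneKbar => coneKb clKb cKb _.
have [|||lam [Klam Alam blam]] :=
    conic_duality K A b v (sup S + eps) coneK clK cK.
- by rewrite -defO.
- by rewrite -defO.
- move=> o; rewrite -defO => Oo; suff : dotv v o <= sup S by lra.
  by apply: ub_le_sup => //; exists o.
have [|||mu [Kmu Gmu gmu]] := conic_duality Kbar G g (- ((Rot x)^T *m v))
    (dotv v (t x) - c - sup S + eps) coneKb clKb cKb.
- by rewrite -defB; exists y0.
- by rewrite -defB.
- move=> y; rewrite -defB => /gapE; rewrite dotvNl dotv_trmx dotvDr; lra.
exists lam, mu; rewrite /cone_le !subr0; split => //.
- rewrite dotvBl (dotvC (A *m t x)) -dotv_trmx Alam.
  by have : eps *+ 3 = c - d; [rewrite /eps; field|lra].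
- by rewrite Gmu -mulmxA Alam addNr.
- by rewrite Alam.
Qed.
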